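(* Let $-\infty\le a<b\le\infty$. Let $A$ be a real-valued regulated function on $[a,b]$ and let $B$ be a real-valued absolutely continuous function such that $B'\in L^1([a,b])$. Then $$\int_a^b A\,dB=\int_a^b A(t)B'(t)\,dt,$$ where the integral on the left is a Henstock--Stieltjes integral and the integral on the right is a Lebesgue integral.
   Context: A function $f$ is regulated on $[a,b]$ if $\lim_{t\to x^-}f(t)$ exists in $\mathbb{R}$ for every $x\in(a,b]$ and $\lim_{t\to y^+}f(t)$ exists in $\mathbb{R}$ for every $y\in[a,b)$; a function given on $(a,b)$ is extended to $[a,b]$ by these limits at the endpoints (in particular $A$ and $B$ are given their limiting values at $\pm\infty$ if these are endpoints). Henstock--Stieltjes integral: a tagged partition of $[a,b]$ is a finite collection $\{([x_{n-1},x_n],z_n)\}_{n=1}^N$ with $a=x_0<x_1<\dots<x_N=b$ and $z_n\in[x_{n-1},x_n]$. A gauge is a function $\gamma$ assigning to each $z\in[a,b]$ an open interval $\gamma(z)$ in $[a,b]$ containing $z$, where intervals $[a,u)$, $(u,v)$, $(u,b]$ with $u,v\in(a,b)$ count as open (a two-point compactification if $a=-\infty$, $b=\infty$). The tagged partition is $\gamma$-fine if $[x_{n-1},x_n]\subset\gamma(z_n)$ for all $n$. For $f,g:[a,b]\to\mathbb{R}$, the integral $\int_a^b f\,dg$ exists and equals $I\in\mathbb{R}$ if for every $\epsilon>0$ there is a gauge $\gamma$ such that $\left|\sum_{n=1}^N f(z_n)[g(x_n)-g(x_{n-1})]-I\right|<\epsilon$ for every $\gamma$-fine tagged partition. *)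

(* Defs.v *)
From HB Require Import structures.
From mathcomp Require Import all_boot all_order all_algebra.
From mathcomp Require Import all_classical all_reals all_analysis.

Set Implicit Arguments.
Unset Strict Implicit.
Unset Printing Implicit Defensive.

Import Order.TTheory GRing.Theory Num.Theory.
Import numFieldNormedType.Exports.

Local Open Scope classical_set_scope.
Local Open Scope ring_scope.

(* An interval of the extended line is given by its end points a b : \bar R.
   A function on [a, b] is a total function on \bar R of which only the values
   on [a, b] matter. *)

(* A function of a real variable seen on the extended line, with its limiting
   values at the infinite points; [lim] is arbitrary when there is no limit. *)
Definition extend (R : realType) (f : R -> R) (x : \bar R) : R :=
  match x with
  | r%:E => f r
  | +oo%E => lim (f t @[t --> +oo])
  | -oo%E => lim (f t @[t --> -oo])
  end.

(* In the topology of \bar R the one-sided limits include those at +oo, -oo. *)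
Definition regulated (R : realType) (a b : \bar R) (f : \bar R -> R) : Prop :=
  (forall x : \bar R, (a < x <= b)%E ->
     cvg (f t @[t --> within [set t | (t < x)%E] (nbhs x)])) /\
  (forall y : \bar R, (a <= y < b)%E ->
     cvg (f t @[t --> within [set t | (y < t)%E] (nbhs y)])).

Definition absolutely_continuous (R : realType) (c d : R) (f : R -> R) : Prop :=
  forall e : R, 0 < e -> exists2 delta : R, 0 < delta &
    forall (n : nat) (u v : nat -> R),
      (forall i, (i < n)%N -> [/\ c <= u i, u i <= v i & v i <= d]) ->
      trivIset `I_n (fun i => `]u i, v i[%classic) ->
      \sum_(i < n) (v i - u i) < delta ->
      \sum_(i < n) `|f (v i) - f (u i)| < e.

(* When a and b are finite this is absolute continuity on [a, b]. On an
   unbounded interval the requirement bears on the compact subintervals; for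
   f' integrable this agrees with the uniform epsilon-delta condition. *)
Definition absolutely_continuous_ereal (R : realType) (a b : \bar R)
    (f : R -> R) : Prop :=
  forall c d : R, (a <= c%:E)%E -> c < d -> (d%:E <= b)%E ->
    absolutely_continuous c d f.

Section HenstockStieltjes.
Context {R : realType}.
Implicit Types (a b : \bar R) (f g : \bar R -> R) (s z : seq (\bar R)).

Definition open_in_itv a b (U : set (\bar R)) : Prop :=
  exists u v : \bar R, [/\ (a < u < b)%E, (a < v < b)%E &
    [\/ U = [set x | (a <= x < u)%E],
        U = [set x | (u < x < v)%E] |
        U = [set x | (u < x <= b)%E]]].

Definition gauge a b (gamma : \bar R -> set (\bar R)) : Prop :=
  forall x : \bar R, (a <= x <= b)%E -> open_in_itv a b (gamma x) /\ gamma x x.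

(* The division points are a :: s, so that the subintervals are
   [nth a (a :: s) i, nth a s i] for i < size s, with tags nth a z i. *)
Definition tagged_partition a b s z : Prop :=
  [/\ itv_partition a b s, size z = size s &
      forall i, (i < size s)%N ->
        (nth a (a :: s) i <= nth a z i <= nth a s i)%E].

Definition fine_partition a (gamma : \bar R -> set (\bar R)) s z : Prop :=
  forall i, (i < size s)%N ->
    [set x | (nth a (a :: s) i <= x <= nth a s i)%E] `<=` gamma (nth a z i).

Definition stieltjes_sum f g a s z : R :=
  \sum_(i < size s) f (nth a z i) * (g (nth a s i) - g (nth a (a :: s) i)).

(* The integral of f with respect to g over [a, b] exists and equals I. *)
Definition is_HS_integral f g a b (I : R) : Prop :=
  forall e : R, 0 < e -> exists2 gamma : \bar R -> set (\bar R),
    gauge a b gamma &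
    forall s z, tagged_partition a b s z -> fine_partition a gamma s z ->
      `|stieltjes_sum f g a s z - I| < e.

End HenstockStieltjes.

(* Main.v *)
Require Import Defs.
From HB Require Import structures.
From mathcomp Require Import all_boot all_order all_algebra.
From mathcomp Require Import all_classical all_reals all_analysis.
From mathcomp Require Import measurable_realfun ring lra.

(** Two independent facts make the theorem true.

    The first is the fundamental theorem of calculus for B: its increments are
    the integrals of B'. The total variation V of an absolutely continuous
    function is again absolutely continuous
    ([absolutely_continuous_total_variation]), so B = V - (V - B) is a
    difference of nondecreasing absolutely continuous functions. Such a
    function F has a Lebesgue-Stieltjes measure, and absolute continuity says
    that this measure vanishes on Lebesgue null sets: a null set lies in a
    disjoint union of open intervals of small total length, on which F grows
    little. The Radon-Nikodym theorem then gives a density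
    ([nondecreasing_absolutely_continuous_density]), and Lebesgue's
    differentiation theorem identifies the density of B with B' almost
    everywhere ([absolutely_continuous_ftc]). Since B' is integrable, the
    formula extends to infinite end points ([extend_primitive]).

    The second concerns A. By compactness of [a, b] in the extended line, for
    each e > 0 a regulated function f is bounded by some M, and outside a
    finite set C it varies by less than e near each point
    ([regulated_finite_oscillation]). Take a gauge that realizes these
    neighbourhoods at the points outside C, and that encloses each c in C in a
    neighbourhood N_c over which the integral of |B'| is tiny. For a fine
    tagged partition, the first fact writes the Stieltjes sum minus the
    integral of A B' as the sum over the subintervals of the integrals of
    (A(z) - A(t)) B'(t), with z the tag. At each t the integrand is at most
    e |B'(t)| if z is outside C, and at most 2 M |B'(t)| with t in N_z if z is
    in C. Hence the error is at most
    e int |B'| + 2 M sum_c int_(N_c) |B'|, which is as small as desired. *)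

Set Implicit Arguments.
Unset Strict Implicit.
Unset Printing Implicit Defensive.

Import Order.TTheory GRing.Theory Num.Theory.
Import numFieldNormedType.Exports.

Local Open Scope classical_set_scope.
Local Open Scope ring_scope.

(** * Total variation of absolutely continuous functions *)

Section total_variation_absolutely_continuous.
Context {R : realType}.
Implicit Types (c d u v : R) (f : R -> R) (p q : R * R) (l : seq (R * R)).

Definition itv_within c d p := [&& c <= p.1, p.1 <= p.2 & p.2 <= d].

(** Disjointness of the open intervals: an empty interval overlaps nothing,
    wherever it is placed. *)
Definition nonoverlap p q := Num.min p.2 q.2 <= Num.max p.1 q.1.

Lemma nonoverlapC p q : nonoverlap p q = nonoverlap q p.
Proof. by rewrite /nonoverlap minC maxC. Qed.

Lemma nonoverlap_within p q r : itv_within p.1 p.2 r ->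
  nonoverlap p q -> nonoverlap r q.
Proof.
rewrite /nonoverlap !ge_min !le_max => /and3P[pr r12 rp].
move=> /orP[/orP[]|/orP[]] h.
- by rewrite (le_trans rp (le_trans h pr)).
- by rewrite (le_trans rp h) orbT.
- by rewrite (le_trans h pr) !orbT.
- by rewrite h !orbT.
Qed.

Lemma nonoverlap_disjoint p q :
  nonoverlap p q <-> `]p.1, p.2[%classic `&` `]q.1, q.2[%classic = set0.
Proof.
split => [|h].
  rewrite /nonoverlap -subset0 => h x [] /=; rewrite !in_itv/=.
  move=> /andP[p1 p2] /andP[q1 q2]; move: h; rewrite leNgt => /negP; apply.
  rewrite (@lt_trans _ _ x)//; first by rewrite gt_max p1.
  by rewrite lt_min p2.
rewrite /nonoverlap leNgt; apply/negP => /midf_lt[].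
set x := (_ / _) => h1 h2.
suff : set0 x by [].
rewrite -h; move: h1 h2; rewrite gt_max lt_min => /andP[p1 q1] /andP[p2 q2].
by split; rewrite /= in_itv/= ?p1 ?q1.
Qed.

(** Lists replace the indexed families of the definition because intervals will
    be subdivided, which for lists is a concatenation. *)
Lemma absolutely_continuous_seq c d f : absolutely_continuous c d f ->
  forall e, 0 < e -> exists2 delta, 0 < delta &
    forall l, all (itv_within c d) l -> pairwise nonoverlap l ->
      \sum_(p <- l) (p.2 - p.1) < delta ->
      \sum_(p <- l) `|f p.2 - f p.1| < e.
Proof.
move=> acf e e0; have [delta d0 H] := acf e e0; exists delta => // l lcd pl.
rewrite !(big_nth (c, c)) !big_mkord => ld.
apply: (H _ (fun i => (nth (c, c) l i).1) (fun i => (nth (c, c) l i).2)) => //.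
- by move=> i il; apply/and3P; move/(all_nthP (c, c)) : lcd; exact.
- have pij i j : (i < j < size l)%N -> nonoverlap (nth (c, c) l i) (nth (c, c) l j).
    move=> /andP[ij jl]; move/(pairwiseP (c, c)) : pl; apply => //.
    by rewrite inE (ltn_trans ij).
  apply/trivIsetP => i j /= il jl; rewrite neq_ltn => /orP[ij|ji].
    by apply/nonoverlap_disjoint/pij; rewrite ij.
  by rewrite setIC; apply/nonoverlap_disjoint/pij; rewrite ji.
Qed.

Lemma variation_nonoverlap u f (s : seq R) : path <%O u s ->
  exists l, [/\ all (itv_within u (last u s)) l, pairwise nonoverlap l,
    \sum_(p <- l) (p.2 - p.1) = last u s - u &
    \sum_(p <- l) `|f p.2 - f p.1| = variation u (last u s) f s].
Proof.
elim: s u => [u _|h t ih u /= /andP[uh ht]].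
  by exists [::]; rewrite !big_nil/= subrr variation_nil.
have [l [lh pl sl vl]] := ih _ ht; exists ((u, h) :: l).
have hl : h <= last h t by exact: (@itv_partition_le _ _ _ _ t).
split => /=.
- rewrite /itv_within/= lexx (ltW uh) hl/=.
  apply: sub_all lh => p /and3P[hp p12 pt].
  by rewrite /itv_within (le_trans (ltW uh) hp) p12.
- rewrite pl andbT; apply: sub_all lh => p /and3P[hp p12 pt].
  by rewrite /nonoverlap/= ge_min !le_max hp !orbT.
- by rewrite big_cons sl/= addrC addrA subrK.
- rewrite big_cons vl/= (@variation_zip _ u (last h t))//; last first.
    by split => //=; rewrite uh.
  by rewrite /= big_cons/= (@variation_zip _ h (last h t)).
Qed.

(** The intervals of [l1] are measured by total variation, those of [l2] by the
    increment of [f]. Subdividing an interval keeps the family disjoint and of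
    the same total length, so that any variation of [f] on an interval can be
    traded for increments; induction on [l1] moves its intervals one by one,
    subdivided, to [l2]. *)
Lemma sum_total_variation_le c d f (e delta : R) :
  (forall l, all (itv_within c d) l -> pairwise nonoverlap l ->
      \sum_(p <- l) (p.2 - p.1) < delta ->
      \sum_(p <- l) `|f p.2 - f p.1| < e) ->
  forall l1 l2, all (itv_within c d) (l1 ++ l2) ->
    pairwise nonoverlap (l1 ++ l2) ->
    \sum_(p <- l1 ++ l2) (p.2 - p.1) < delta ->
  (\sum_(p <- l1) total_variation p.1 p.2 f +
   (\sum_(p <- l2) `|f p.2 - f p.1|)%:E <= e%:E)%E.
Proof.
move=> H; elim=> [l2 lcd pl sl|p l1 ih l2 /= /andP[pcd lcd] /andP[pl12 pl] sl].
  by rewrite big_nil add0e lee_fin ltW// H.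
have p12 : p.1 <= p.2 by case/and3P : pcd.
have tv0 : (0 <= \sum_(p <- l1) total_variation p.1 p.2 f)%E.
  rewrite big_seq sume_ge0// => q ql1; apply: total_variation_ge0.
  have : q \in l1 ++ l2 by rewrite mem_cat ql1.
  by move/(allP lcd) => /and3P[].
have s2 : 0 <= \sum_(p <- l2) `|f p.2 - f p.1| by rewrite sumr_ge0.
have tvfin : (\sum_(p <- l1) total_variation p.1 p.2 f)%E \is a fin_num.
  rewrite ge0_fin_numE//; apply: (@le_lt_trans _ _ e%:E); last exact: ltry.
  apply: le_trans (ih l2 lcd pl _); first by rewrite leeDl// lee_fin.
  by apply: le_lt_trans sl; rewrite big_cons lerDr subr_ge0.
rewrite big_cons -addeA -leeBrDr; last by rewrite fin_numD tvfin.
apply: ge_ereal_sup => _ [_ [s [us /eqP sv]] <-] <-.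
rewrite leeBrDr; last by rewrite fin_numD tvfin.
have [l []] := variation_nonoverlap f us.
rewrite sv => lp pwl sml <-; rewrite addeCA -EFinD -big_cat.
apply: ih.
- move: lcd; rewrite !all_cat => /andP[-> ->]; rewrite andbT/=.
  apply: sub_all lp => q /and3P[pq q12 qp].
  case/and3P : pcd => cp _ pd.
  by rewrite /itv_within (le_trans cp pq) q12 (le_trans qp pd).
- move: pl pl12; rewrite all_cat !pairwise_cat => /and3P[al12 -> ->] /andP[pl1 pl2].
  rewrite allrel_catr al12 pwl !andbT/=; apply/andP; split.
    apply/allrelP => x y xl1 yl; rewrite nonoverlapC.
    by apply: (@nonoverlap_within p); [exact: (allP lp)|exact: (allP pl1)].
  apply/allrelP => x y xl yl2.
  by apply: (@nonoverlap_within p); [exact: (allP lp)|exact: (allP pl2)].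
- move: sl; rewrite big_cons !big_cat/= sml; apply: le_lt_trans.
  by rewrite addrCA.
Qed.

(** The total variation is at most 1 on an interval shorter than the [delta] of
    e = 1, and finitely many such intervals cover [c, d]. *)
Lemma absolutely_continuous_total_variation_fin c d f :
  absolutely_continuous c d f ->
  forall x, c <= x <= d -> total_variation c x f \is a fin_num.
Proof.
move=> /absolutely_continuous_seq/(_ _ ltr01)[delta d0 H].
have small u v : c <= u -> u <= v -> v <= d -> v - u < delta ->
    (total_variation u v f <= 1%:E)%E.
  move=> cu uv vd uvd.
  have := @sum_total_variation_le _ _ _ _ _ H [:: (u, v)] [::].
  rewrite /= !big_cons !big_nil/= adde0 addr0 /itv_within/= cu uv vd adde0.
  exact.
move=> x /andP[cx xd].
suff [k xk] : exists k : nat, x <= c + k%:R * (delta / 2).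
  elim: k x cx xd xk => [|k ih] x cx xd.
    rewrite mul0r addr0 => xc.
    have -> : x = c by apply/eqP; rewrite eq_le xc.
    by rewrite total_variationxx.
  have [xk _|kx xk] := leP x (c + k%:R * (delta / 2)); first exact: ih.
  have ck : c <= c + k%:R * (delta / 2).
    by rewrite lerDl mulr_ge0// ltW// divr_gt0.
  rewrite (total_variationD f ck (ltW kx)) fin_numD ih//=; last first.
    exact: le_trans (ltW kx) xd.
  rewrite ge0_fin_numE; last exact/total_variation_ge0/ltW.
  apply: le_lt_trans (ltry 1); apply: small => //; first exact: ltW.
  by move: xk; rewrite -natr1 mulrDl mul1r; lra.
exists (Num.bound ((x - c) / (delta / 2))).
rewrite -lerBlDl -ler_pdivrMr ?divr_gt0//.
by apply/ltW/archi_boundP; rewrite divr_ge0 ?subr_ge0// divr_ge0// ltW.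
Qed.

Lemma absolutely_continuous_total_variation c d f :
  absolutely_continuous c d f ->
  absolutely_continuous c d (fun x => fine (total_variation c x f)).
Proof.
move=> acf e e0; have e20 : 0 < e / 2 by rewrite divr_gt0.
have tvfin := absolutely_continuous_total_variation_fin acf.
have [delta d0 H] := absolutely_continuous_seq acf e20.
exists delta => // n u v uv tuv suv.
pose l := [seq (u i, v i) | i <- index_iota 0 n].
have lcd : all (itv_within c d) l.
  apply/allP => _ /mapP[i + ->]; rewrite mem_index_iota => /andP[_ /uv[cu ui vd]].
  by rewrite /itv_within/= cu ui vd.
have pl : pairwise nonoverlap l.
  rewrite /l pairwise_map; apply/(pairwiseP 0%N) => i j.
  rewrite /index_iota subn0 !inE size_iota => ni nj ij; rewrite /= !nth_iota// !add0n.
  apply/nonoverlap_disjoint.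
  by move/trivIsetP : tuv => /(_ i j ni nj); rewrite ltn_eqF//; exact.
have := @sum_total_variation_le _ _ _ _ _ H l [::]; rewrite /l.
rewrite cats0 !big_nil adde0 !big_map !big_mkord => /(_ lcd pl suv).
rewrite (_ : (\sum_(i < n) _)%E =
  (\sum_(i < n) `|fine (total_variation c (v i) f) -
    fine (total_variation c (u i) f)|)%:E); last first.
  rewrite -sumEFin; apply: eq_bigr => i _.
  have [cu ui vd] := uv i (ltn_ord i).
  have fu : total_variation c (u i) f \is a fin_num.
    by rewrite tvfin// cu (le_trans ui).
  have fv : total_variation c (v i) f \is a fin_num.
    by rewrite tvfin// vd andbT (le_trans cu).
  move: (fv); rewrite (total_variationD f cu ui) fin_numD => /andP[_ fuv].
  by rewrite fineD// addrAC subrr add0r ger0_norm ?fineK// fine_ge0// total_variation_ge0.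
by rewrite lee_fin => /le_lt_trans; apply; rewrite ltr_pdivrMr// ltr_pMr// ltr1n.
Qed.

Lemma absolutely_continuousB c d f g : absolutely_continuous c d f ->
  absolutely_continuous c d g -> absolutely_continuous c d (f \- g).
Proof.
move=> acf acg e e0; have e20 : 0 < e / 2 by rewrite divr_gt0.
have [d1 d10 H1] := acf _ e20; have [d2 d20 H2] := acg _ e20.
exists (Num.min d1 d2); first by rewrite lt_min d10.
move=> n u v uv tuv; rewrite lt_min => /andP[s1 s2].
rewrite [ltRHS]splitr; apply: le_lt_trans (ltrD (H1 _ _ _ uv tuv s1) (H2 _ _ _ uv tuv s2)).
rewrite -big_split/=; apply: ler_sum => i _.
rewrite [X in `|X|](_ : _ = f (v i) - f (u i) - (g (v i) - g (u i))); last by rewrite /=; lra.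
exact: ler_normB.
Qed.

End total_variation_absolutely_continuous.

(** * The fundamental theorem of calculus for absolutely continuous functions *)

Section absolutely_continuous_density.
Context {R : realType}.
Local Notation mu := (@lebesgue_measure R).
Implicit Types (c d x y : R) (f F : R -> R).

(** The nearest point of [c, d], which turns a function on [c, d] into one on the
    line, constant outside [c, d]. *)
Definition clamp c d x := Num.max c (Num.min d x).

Lemma clamp_within c d x : c <= d -> c <= clamp c d x <= d.
Proof. by move=> cd; rewrite /clamp le_max lexx/= ge_max cd ge_min lexx. Qed.

Lemma clamp_id c d x : c <= x <= d -> clamp c d x = x.
Proof. by move=> /andP[cx xd]; rewrite /clamp (min_idPr xd) (max_idPr cx). Qed.

Lemma clamp_nondecreasing c d : {homo clamp c d : x y / x <= y}.
Proof.
move=> x y xy; rewrite /clamp ge_max !le_max lexx/= le_min !ge_min lexx xy.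
by rewrite !orbT.
Qed.

Lemma clamp_lipschitz c d x y : c <= d -> x <= y ->
  clamp c d y - clamp c d x <= y - x.
Proof.
move=> cd xy; rewrite /clamp.
by case: (leP d y) => dy; case: (leP d x) => dx;
  case: (leP c d) => cd'; case: (leP c y) => cy; case: (leP c x) => cx; lra.
Qed.

Lemma open_interval_finite_measure (I : set R) :
  open I -> is_interval I -> (mu I < +oo)%E ->
  exists u v, u <= v /\ I = `]u, v[%classic.
Proof.
move=> oI iI; move: oI; rewrite ((is_intervalP I).1 iI) {iI}.
move: (Rhull I) => i /interior_id io.
rewrite lebesgue_measure_itv -io {io}.
have e0 : exists u v : R, u <= v /\ set0 = `]u, v[%classic.
  by exists 0, 0; rewrite set_itvoo0.
case: i => -[b1 x|[|]] [b2 y|[|]] //=;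
  rewrite ?interior_itv ?ltNyy ?ltNyr ?ltry//=; last 5 first.
- by rewrite set_itvE interior0.
- by rewrite set_itvE interior0.
- by rewrite set_itvE interior0.
- by rewrite set_itvE interior0.
- by rewrite set_itvE interior0.
move=> _; have [xy|yx] := leP x y; first by exists x, y.
by exists 0, 0; split => //; rewrite !set_itv_ge// bnd_simp -leNgt// ltW.
Qed.


Section density_of_nondecreasing.
Variables (c d : R) (F : R -> R).
Hypothesis cd : c < d.
Hypothesis ndF : {in `[c, d] &, {homo F : x y / x <= y}}.
Hypothesis acF : absolutely_continuous c d F.

Let G x := F (clamp c d x).

Let G_nondecreasing : nondecreasing G.
Proof.
move=> x y xy; have cd' := ltW cd.
by apply: ndF; rewrite ?in_itv/= ?clamp_within//; exact: clamp_nondecreasing.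
Qed.

Let G_right_continuous : right_continuous G.
Proof.
apply: right_continuousW => x; apply/cvgrPdist_lt => e e0.
have [delta d0 H] := acF e0.
have small u v : u <= v -> v - u < delta -> `|G v - G u| < e.
  move=> uv uvd.
  have := H 1%N (fun=> clamp c d u) (fun=> clamp c d v).
  rewrite !big_ord1; apply.
  - move=> i _; have /andP[-> _] := clamp_within u (ltW cd).
    by have /andP[_ ->] := clamp_within v (ltW cd); rewrite clamp_nondecreasing.
  - by move=> i j /= + + _; rewrite !ltnS !leqn0 => /eqP -> /eqP ->.
  - by apply: le_lt_trans uvd; apply: clamp_lipschitz => //; exact: ltW.
exists delta => //= y; rewrite /ball_ /= => xy.
have [yx|/ltW xy'] := leP y x; last first.
  by rewrite distrC; apply: small => //; move: xy; rewrite distrC ger0_norm ?subr_ge0.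
by apply: small => //; move: xy; rewrite ger0_norm ?subr_ge0.
Qed.

Let Gc : cumulative R R := HB.pack G
  (isCumulative.Build R _ R G G_nondecreasing G_right_continuous).

Let nu0 : {measure set (measurableTypeR R) -> \bar R} :=
  lebesgue_stieltjes_measure Gc.

Let nu0_itv u v : u <= v -> nu0 `]u, v]%classic = (G v - G u)%:E.
Proof.
move=> uv; rewrite /nu0/= /lebesgue_stieltjes_measure /measure_extension.
by rewrite measurable_mu_extE/= ?wlength_itv_bnd//; exact: is_ocitv.
Qed.

Let nu0_le (A B : set R) : measurable A -> measurable B ->
  A `<=` B -> (nu0 A <= nu0 B)%E.
Proof. by move=> mA mB AB; rewrite le_measure ?inE. Qed.

Let mu_le (A B : set R) : measurable A -> measurable B ->
  A `<=` B -> (mu A <= mu B)%E.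
Proof. by move=> mA mB AB; rewrite le_measure ?inE. Qed.

Let nu0_fin : (nu0 `]c, d]%classic < +oo)%E.
Proof. by rewrite nu0_itv ?ltry// ltW. Qed.

Let mcd : measurable (`]c, d]%classic : set (measurableTypeR R)).
Proof. exact: measurable_itv. Qed.

Let nu : {finite_measure set (measurableTypeR R) -> \bar R} :=
  mfrestr mcd nu0_fin.

(** Cover the part of N in ]c, d] by an open set of measure less than delta,
    decompose that set into disjoint open intervals, and apply absolute
    continuity to the first n of them, clamped to [c, d]. *)
Let nu0_null (N : set R) : measurable N -> mu N = 0%E ->
  nu0 (N `&` `]c, d]%classic) = 0%E.
Proof.
move=> mN N0; pose N' : set R := N `&` `]c, d]%classic; rewrite -/N'.
have mN' : measurable N' by exact: measurableI.
have N'0 : mu N' = 0%E.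
  by apply: (@subset_measure0 _ _ _ mu _ N) => //; exact: subIsetl.
apply/eqP; rewrite eq_le measure_ge0 andbT; apply/lee_addgt0Pr => e e0.
rewrite add0e.
have [delta d0 H] := acF e0.
have [||U [oU NU Ud]] := @lebesgue_regularity_outer R N' delta _ _ d0 => //.
  by rewrite [X in (X < _)%E]N'0 ltry.
have mU : measurable U by exact: open_measurable.
have muU : (mu U < delta%:E)%E.
  apply: le_lt_trans Ud.
  have -> : (mu U = mu (U `\` N') + mu (U `&` N'))%E by exact: measureDI.
  rewrite [X in (_ + X)%E](_ : _ = 0)%E ?adde0//.
  by apply: (@subset_measure0 _ _ _ mu _ N') => //; exact: measurableI.
pose I := open_disjoint_itv oU.
have mI i : measurable (I i) by apply: open_measurable; exact: open_disjoint_itv_open.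
have IU i : I i `<=` U.
  by rewrite [X in _ `<=` X](open_disjoint_itv_bigcup oU) => x Ix; exists i.
have /choice[uv uvI] : forall i, exists uv : R * R,
    uv.1 <= uv.2 /\ I i = `]uv.1, uv.2[%classic.
  move=> i; have [| | |u [v [uv Iuv]]] := @open_interval_finite_measure (I i).
  - exact: open_disjoint_itv_open.
  - exact: open_disjoint_itv_is_interval.
  - apply: le_lt_trans (ltry delta); apply: le_trans (ltW muU).
    exact: mu_le.
  - by exists (u, v).
have tI : trivIset setT I by exact: open_disjoint_itv_trivIset.
apply: (@le_trans _ _ (\sum_(i <oo) nu0 (I i))%E).
  apply: measure_sigma_subadditive => //.
  by rewrite -(open_disjoint_itv_bigcup oU).
apply: lime_le; first by apply: is_cvg_nneseries => i _ _; exact: measure_ge0.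
apply: nearW => n; rewrite big_mkord.
apply: (@le_trans _ _ (\sum_(i < n) (G (uv i).2 - G (uv i).1)%:E)%E).
  apply: lee_sum => i _; have [uvi Ii] := uvI i; rewrite -nu0_itv//.
  by apply: nu0_le => //; rewrite Ii; apply: subset_itvl; rewrite bnd_simp.
rewrite sumEFin lee_fin ltW//.
apply: le_lt_trans (H n (fun i => clamp c d (uv i).1) (fun i => clamp c d (uv i).2) _ _ _).
- by apply: ler_sum => i _; exact: ler_norm.
- move=> i _; have /andP[-> _] := clamp_within (uv i).1 (ltW cd).
  have /andP[_ ->] := clamp_within (uv i).2 (ltW cd).
  by rewrite clamp_nondecreasing// (uvI i).1.
- move=> i j _ _ [x [ix jx]]; apply: tI => //.
  have sub k : `]clamp c d (uv k).1, clamp c d (uv k).2[%classic x -> I k x.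
    rewrite (uvI k).2 /= !in_itv/= /clamp.
    rewrite gt_max lt_max !lt_min gt_min => /andP[/andP[cx /orP[dx|->/=]]].
      move=> /orP[|/andP[xd _]]; first by rewrite ltNge ltW.
      by move: (lt_trans dx xd); rewrite ltxx.
    by move=> /orP[|/andP[_ ->//]]; rewrite ltNge ltW.
  by exists x; split; apply: sub.
- rewrite -lte_fin; apply: le_lt_trans muU; rewrite -sumEFin.
  apply: (@le_trans _ _ (\sum_(i < n) mu (I i))%E).
    apply: lee_sum => i _; have [uvi ->] := uvI i.
    rewrite lebesgue_measure_itv/= lte_fin; case: ifPn => [_|].
      by rewrite -EFinD lee_fin; apply: clamp_lipschitz => //; exact: ltW.
    rewrite -leNgt => vu; have -> : (uv i).1 = (uv i).2 by apply/eqP; rewrite eq_le uvi.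
    by rewrite subrr.
  rewrite -measure_bigsetU//; apply: mu_le => //; first exact: bigsetU_measurable.
  by rewrite -bigcup_mkord => x [i _ Ix]; exact: IU Ix.
Qed.

Let nu_dominated : nu `<< mu.
Proof. by apply/null_content_dominatesP => N mN N0; exact: nu0_null. Qed.

(** Radon-Nikodym derivative of the Lebesgue-Stieltjes measure of F, restricted to
    ]c, d] to make it finite. *)
Lemma nondecreasing_absolutely_continuous_density : exists2 g : R -> R,
  mu.-integrable setT (EFin \o g) &
  forall x, c <= x <= d -> F x - F c = \int[mu]_(t in `]c, x]) g t.
Proof.
have [g [g0 gfin intg nuE]] :=
  @radon_nikodym_sigma_finite _ _ _ mu nu nu_dominated.
have gE : EFin \o (fine \o g) = g by apply/funext => t /=; rewrite fineK.
exists (fine \o g); first by rewrite gE.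
move=> x /andP[cx xd].
have -> : F x - F c = G x - G c.
  by rewrite /G !clamp_id// ?lexx ?cx// ltW.
have /= := nuE _ (measurable_itv `]c, x]).
rewrite /nu /mfrestr /mrestr/= setIidl; last first.
  by apply: subset_itvl; rewrite bnd_simp.
rewrite nu0_itv// => nuE'; rewrite /Rintegral.
by under eq_integral do rewrite /= fineK//; rewrite -nuE'.
Qed.

End density_of_nondecreasing.

(** With V the total variation, V and V - f are nondecreasing and absolutely
    continuous; the density of f is the difference of theirs. *)
Lemma absolutely_continuous_density c d f : c < d ->
  absolutely_continuous c d f -> exists2 g : R -> R,
  mu.-integrable setT (EFin \o g) &
  forall x, c <= x <= d -> f x - f c = \int[mu]_(t in `]c, x]) g t.
Proof.
move=> cd acf; pose V x := fine (total_variation c x f).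
have acV : absolutely_continuous c d V.
  exact: absolutely_continuous_total_variation.
have acW := absolutely_continuousB acV acf.
have tvfin := absolutely_continuous_total_variation_fin acf.
have VD x y : c <= x -> x <= y -> y <= d ->
    V y = V x + fine (total_variation x y f).
  move=> cx xy yd; have := tvfin y; rewrite yd (le_trans cx xy) => /(_ isT).
  rewrite /V (total_variationD f cx xy) fin_numD => /andP[fx fy].
  by rewrite fineD.
have tvge x y : c <= x -> x <= y -> y <= d ->
    `|f y - f x| <= fine (total_variation x y f).
  move=> cx xy yd; have := tvfin y; rewrite yd (le_trans cx xy) => /(_ isT).
  rewrite (total_variationD f cx xy) fin_numD => /andP[_ fy].
  by rewrite -lee_fin fineK// total_variation_ge.
have ndV : {in `[c, d] &, {homo V : x y / x <= y}}.
  move=> x y; rewrite !in_itv/= => /andP[cx xd] /andP[cy yd] xy.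
  by rewrite (VD x y)// lerDl fine_ge0// total_variation_ge0.
have ndW : {in `[c, d] &, {homo (V \- f) : x y / x <= y}}.
  move=> x y; rewrite !in_itv/= => /andP[cx xd] /andP[cy yd] xy /=.
  rewrite (VD x y)//; have := tvge _ _ cx xy yd.
  by have := ler_norm (f y - f x); lra.
have [g1 ig1 g1E] := nondecreasing_absolutely_continuous_density cd ndV acV.
have [g2 ig2 g2E] := nondecreasing_absolutely_continuous_density cd ndW acW.
exists (g1 \- g2) => [|x cxd].
  rewrite (_ : EFin \o _ = (EFin \o g1) \- (EFin \o g2))%E.
    exact: integrableB.
  by apply/funext => t; rewrite /= EFinB.
rewrite RintegralB//; last 2 first.
- exact: integrableS ig1.
- exact: integrableS ig2.
by rewrite -g1E// -g2E//=; lra.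
Qed.

(** Near an interior point, f differs by a constant from the integral of its
    density, whose derivative is the density at almost every point. *)
Lemma absolutely_continuous_ftc c d f : c < d ->
  absolutely_continuous c d f ->
  measurable_fun `]c, d]%classic (f^`())%classic ->
  f d - f c = \int[mu]_(t in `]c, d]) (f^`())%classic t.
Proof.
move=> cd acf mf; have [g ig gE] := absolutely_continuous_density cd acf.
rewrite gE ?lexx ?ltW//; congr fine.
have mg : measurable_fun [set: R] g.
  by apply/measurable_EFinP; exact: measurable_int ig.
apply: ae_eq_integral => //.
- apply/measurable_EFinP; exact: measurable_funTS.
- exact/measurable_EFinP.
have igx y : mu.-integrable [set` Interval (BRight c) (BRight y)] (EFin \o g).
  exact: integrableS ig.
have locg : locally_integrable [set: R] g.
  by apply: open_integrable_locally => //; exact: openT.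
(* The derivative is two-sided, and f is arbitrary beyond d. *)
have neq_d : {ae mu, forall t, t != d}.
  exists [set d]; split => //; first by rewrite lebesgue_measure_set1.
  by move=> t /= /negP; rewrite negbK => /eqP.
move: neq_d (FTC1 igx locg).
apply: filterS2; first exact: (ae_filter_ringOfSetsType mu).
move=> t td + /= /[!in_itv]/= /andP[ct tle].
move=> /(_ ct)[dG Gg].
have {tle td}td : t < d by rewrite lt_neqAle td.
pose G x := \int[mu]_(t in `]c, x]) g t.
congr (_%:E); rewrite -Gg -/G !derive1E.
have -> : 'D_1 f t = 'D_1 (G \+ cst (f c)) t.
  apply: near_eq_derive; near=> x.
  have cxd : c <= x <= d by apply/andP; split; apply/ltW; near: x;
    [exact: lt_nbhsr|exact: lt_nbhsl].
  by rewrite /G/= -gE// subrK.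
by rewrite deriveD// derive_cst addr0.
Unshelve. all: by end_near. Qed.

End absolutely_continuous_density.

(** * Integrals over intervals with extended end points *)

Section integral_on_extended_line.
Context {R : realType}.
Local Notation mu := (@lebesgue_measure R).
Implicit Types (x y c : \bar R) (h : R -> R) (D : set R).

Definition real_itvoc x y : set R := [set t | (x < t%:E <= y)%E].

Definition real_itvcc x y : set R := [set t | (x <= t%:E <= y)%E].

Lemma measurable_real_itvoc x y : measurable (real_itvoc x y).
Proof.
apply: is_interval_measurable => u v /= /andP[xu _] /andP[_ vy] w /andP[uw wv].
by apply/andP; split; [apply: lt_le_trans xu _|apply: le_trans _ vy];
  rewrite lee_fin.
Qed.

Lemma measurable_real_itvcc x y : measurable (real_itvcc x y).
Proof.
apply: is_interval_measurable => u v /= /andP[xu _] /andP[_ vy] w /andP[uw wv].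
by apply/andP; split; [apply: le_trans xu _|apply: le_trans _ vy];
  rewrite lee_fin.
Qed.

(** The metric of the extended line is transported by [contract], which is
    monotone: balls are intervals. *)
Lemma measurable_real_ball c (e : R) :
  measurable [set t : R | ball c e t%:E].
Proof.
apply: is_interval_measurable => u v /=.
rewrite /ball/= /ereal_ball !ltr_distlC => /andP[xu _] /andP[_ vy] w /andP[uw wv].
rewrite /= /ball/= /ereal_ball ltr_distlC; apply/andP; split.
  by apply: lt_le_trans xu _; rewrite (le_contract u%:E w%:E) lee_fin.
by apply: le_lt_trans vy; rewrite (le_contract w%:E v%:E) lee_fin.
Qed.

Lemma ball_separated c (t : R) : t%:E != c ->
  \forall n \near \oo, ~ ball c n.+1%:R^-1 t%:E.
Proof.
move=> tc; have d0 : 0 < `|contract c - contract t%:E|.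
  rewrite normr_gt0 subr_eq0; apply: contra tc => /eqP/contract_inj ->.
  by rewrite eqxx.
near=> n; rewrite /ball/= /ereal_ball; apply/negP; rewrite -leNgt ltW//.
by near: n; exact: near_infty_natSinv_lt (PosNum d0).
Unshelve. all: by end_near. Qed.

(** Absolute continuity of the integral at a point, finite or not: the integral
    of |h| over the balls of radius 1/(k+1) around c tends to 0 by dominated
    convergence, because these balls shrink to c. *)
Lemma integral_nbhs_small D h c (e : R) : measurable D ->
  mu.-integrable D (EFin \o h) -> 0 < e ->
  exists N : set (\bar R), [/\ nbhs c N, measurable [set t : R | N t%:E] &
    \int[mu]_(t in D `&` [set t : R | N t%:E]) `|h t| < e].
Proof.
move=> mD ih e0.
pose S k := [set t : R | ball c k.+1%:R^-1 t%:E].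
have mS k : measurable (S k) by exact: measurable_real_ball.
have mh : measurable_fun D h by apply/measurable_EFinP; exact: measurable_int ih.
pose f_ k := EFin \o ((fun t => `|h t|) \_ (S k)).
have f_E k t : f_ k t = (`|h t| * \1_(S k) t)%:E.
  by rewrite /f_ /= patch_indic.
have [|||||_ _] := @dominated_convergence _ _ _ mu D mD f_ (cst 0%E)
    (EFin \o (fun t => `|h t|)).
- move=> k; rewrite (_ : f_ k = EFin \o (fun t => `|h t| * \1_(S k) t)); last first.
    by apply/funext => t; rewrite f_E.
  apply/measurable_EFinP; apply: measurable_funM; first exact: measurableT_comp.
  by apply: measurable_indic; exact: mS.
- exact: measurable_cst.
- exists [set fine c]; split;
    [exact: measurable_set1|exact: lebesgue_measure_set1|].
  move=> t /= tP; apply: contrapT => tc; apply: tP => Dt.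
  apply: cvg_near_cst; apply: filterS (ball_separated (_ : t%:E != c)).
    by move=> k nS; rewrite f_E indicE memNset// mulr0.
  by apply/eqP => tc'; apply: tc; rewrite -tc'.
- exact: integrable_norm.
- apply: aeW => t k Dt; rewrite f_E /= lee_fin indicE.
  by case: (_ \in _); rewrite ?mulr1 ?mulr0 ?normr_id ?normr0.
rewrite integral0 => /fine_cvg/cvgr_lt/(_ _ e0)/filter_ex[k /= kE].
exists (ball c k.+1%:R^-1); split; first by apply: nbhsx_ballx.
  exact: measurable_real_ball.
by rewrite Rintegral_mkcondr.
Qed.

Lemma ereal_between x y : (x < y)%E -> exists p : R, (x < p%:E < y)%E.
Proof.
move: x y => [r| |] [s| |]//= xy.
- by exists ((r + s) / 2); rewrite lte_fin in xy; rewrite !lte_fin midf_lt// midf_lt.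
- by exists (r + 1); rewrite lte_fin ltry ltrDl ltr01.
- by exists (s - 1); rewrite lte_fin ltNyr gtrDl ltrN10.
- by exists 0; rewrite ltry ltNyr.
Qed.

Lemma Rintegral_norm_subset D E h : measurable D -> measurable E -> E `<=` D ->
  mu.-integrable D (EFin \o h) ->
  \int[mu]_(t in E) `|h t| <= \int[mu]_(t in D) `|h t|.
Proof.
move=> mD mE ED ih; have inh := integrable_norm ih.
rewrite /Rintegral fine_le//.
- by apply: integrable_fin_num => //; exact: integrableS inh.
- exact: integrable_fin_num.
- by apply: ge0_subset_integral => //; exact: measurable_int inh.
Qed.

Section primitive.
Variables (a b : \bar R) (h : R -> R).
Hypothesis ih : mu.-integrable (real_itvcc a b) (EFin \o h).

Definition primitive x := \int[mu]_(t in real_itvoc a x) h t.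

Lemma real_itvoc_sub x y : (a <= x)%E -> (y <= b)%E ->
  real_itvoc x y `<=` real_itvcc a b.
Proof.
move=> ax yb t /= /andP[xt ty]; apply/andP; split.
  by rewrite ltW// (le_lt_trans ax).
exact: le_trans ty yb.
Qed.

Lemma integrable_real_itvoc x y : (a <= x)%E -> (y <= b)%E ->
  mu.-integrable (real_itvoc x y) (EFin \o h).
Proof.
move=> ax yb; apply: integrableS ih.
- exact: measurable_real_itvcc.
- exact: measurable_real_itvoc.
- exact: real_itvoc_sub.
Qed.

Lemma primitiveB x y : (a <= x)%E -> (x <= y)%E -> (y <= b)%E ->
  primitive y - primitive x = \int[mu]_(t in real_itvoc x y) h t.
Proof.
move=> ax xy yb; rewrite /primitive.
have -> : real_itvoc a y = real_itvoc a x `|` real_itvoc x y.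
  apply/seteqP; split => t /=.
    by move=> /andP[at_ ty]; have [xt|tx] := ltP x t%:E;
      [right; apply/andP|left; apply/andP].
  move=> [/andP[at_ tx]|/andP[xt ty]]; apply/andP.
    by rewrite at_ (le_trans tx xy).
  by rewrite ty (le_lt_trans ax xt).
rewrite Rintegral_setU//; first by rewrite addrAC subrr add0r.
- exact: measurable_real_itvoc.
- exact: measurable_real_itvoc.
- apply: integrableS ih; [exact: measurable_real_itvcc| |].
    by apply: measurableU; exact: measurable_real_itvoc.
  by move=> t [|]; apply: real_itvoc_sub => //; exact: le_trans xy yb.
- apply/disj_setPS => t [/= /andP[_ tx] /andP[xt _]].
  by move: (le_lt_trans tx xt); rewrite ltxx.
Qed.

Lemma primitive_dist (N : set (\bar R)) x y :
  (a <= x)%E -> (x <= y)%E -> (y <= b)%E ->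
  measurable [set t : R | N t%:E] ->
  (forall t, (x < t <= y)%E -> N t) ->
  `|primitive y - primitive x| <=
    \int[mu]_(t in real_itvcc a b `&` [set t : R | N t%:E]) `|h t|.
Proof.
move=> ax xy yb mN xyN; rewrite primitiveB//.
apply: le_trans (le_normr_Rintegral _ _) _.
- exact: measurable_real_itvoc.
- exact: integrable_real_itvoc.
apply: Rintegral_norm_subset.
- by apply: measurableI => //; exact: measurable_real_itvcc.
- exact: measurable_real_itvoc.
- move=> t xty; split; last exact: xyN.
  exact: real_itvoc_sub xty.
- apply: integrableS ih; [exact: measurable_real_itvcc| |exact: subIsetl].
  by apply: measurableI => //; exact: measurable_real_itvcc.
Qed.

Lemma Rintegral_real_itvcc : (a <= b)%E ->
  \int[mu]_(t in real_itvcc a b) h t = primitive b.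
Proof.
move=> ab; pose E : set R := [set t | t%:E = a].
have [mE E0] : measurable E /\ \int[mu]_(t in E) h t = 0.
  rewrite /E; case: (a) => [r| |].
  - rewrite (_ : [set t | _] = [set r]); last first.
      by apply/seteqP; split => t /= => [[->]|->].
    by rewrite Rintegral_set1; split => //; exact: measurable_set1.
  - rewrite (_ : [set t | _] = set0); last by apply/seteqP; split.
    by rewrite Rintegral_set0; split.
  - rewrite (_ : [set t | _] = set0); last by apply/seteqP; split.
    by rewrite Rintegral_set0; split.
have ccE : real_itvcc a b = E `|` real_itvoc a b.
  apply/seteqP; split => t /=.
    move=> /andP[]; rewrite le_eqVlt => /predU1P[at_ _|at_ tb].
      by left; rewrite /E/= -at_.
    by right; apply/andP.
  move=> [ta|/andP[at_ tb]]; apply/andP; last by rewrite (ltW at_) tb.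
  by rewrite (ta : t%:E = a) lexx ab.
rewrite ccE Rintegral_setU//.
- by rewrite E0 add0r.
- exact: measurable_real_itvoc.
- by rewrite -ccE.
- apply/disj_setPS => t [/= ta /andP[at_ _]].
  by move: at_; rewrite ta ltxx.
Qed.

End primitive.

Section fundamental_theorem.
Variables (a b : \bar R) (B : R -> R).
Hypothesis ab : (a < b)%E.
Hypothesis acB : absolutely_continuous_ereal a b B.
Let B' : R -> R := (B^`())%classic.
Hypothesis iB' : mu.-integrable (real_itvcc a b) (EFin \o B').

Let P := primitive a B'.

Let primitive_derive (u v : R) : (a <= u%:E)%E -> u <= v -> (v%:E <= b)%E ->
  B v - B u = P v%:E - P u%:E.
Proof.
move=> au uv vb; rewrite (primitiveB iB')// ?lee_fin//.
have -> : real_itvoc u%:E v%:E = `]u, v]%classic.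
  by apply/seteqP; split => t; rewrite /real_itvoc/= in_itv/= lte_fin lee_fin.
move: uv; rewrite le_eqVlt => /predU1P[<-|uv].
  by rewrite subrr set_itv_ge ?Rintegral_set0// bnd_simp ltxx.
apply: absolutely_continuous_ftc => //; first exact: acB.
have mB' : measurable_fun (real_itvcc a b) (EFin \o B').
  exact: measurable_int iB'.
apply/measurable_EFinP; apply: measurable_funS mB'.
  exact: measurable_real_itvcc.
move=> t /=; rewrite in_itv/= => /andP[ut tv]; apply/andP; split.
  by rewrite (le_trans au)// lee_fin ltW.
by rewrite (le_trans _ vb)// lee_fin.
Qed.

(** At an infinite end point the value of [extend B] is a limit, which exists
    because [primitive] is continuous there: the integral of |B'| near that
    point is small. *)
Lemma extend_primitive : exists K : R, forall x, (a <= x <= b)%E ->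
  extend B x = primitive a B' x + K.
Proof.
have [p /andP[ap pb]] : exists p : R, (a < p%:E < b)%E.
  exact: ereal_between.
exists (B p - P p%:E) => x.
have realE (t : R) : (a <= t%:E)%E -> (t%:E <= b)%E ->
    B t = P t%:E + (B p - P p%:E).
  move=> at_ tb; have [pt|/ltW tp] := leP p t.
    by have := primitive_derive (ltW ap) pt tb; lra.
  by have := primitive_derive at_ tp (ltW pb); lra.
case: x => [t /andP[]|/andP[_ yb]|/andP[aNy _]]; first exact: realE.
- have bE : b = +oo%E by apply/eqP; rewrite eq_le leey.
  apply: cvg_lim; first exact: Rhausdorff.
  apply/cvgrPdist_lt => e e0.
  have [N [+ mN Ne]] := integral_nbhs_small +oo%E (measurable_real_itvcc a b) iB' e0.
  move=> [M [_ MN]]; near=> t.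
  have at_ : (a <= t%:E)%E.
    apply: le_trans (ltW ap) _; rewrite lee_fin.
    by near: t; apply: nbhs_pinfty_ge; exact: num_real.
  rewrite (realE t) ?bE ?leey// opprD addrACA subrr addr0.
  apply: le_lt_trans Ne; apply: primitive_dist => //; rewrite ?leey//.
  move=> y /andP[ty _]; apply: MN; apply: le_lt_trans ty; rewrite lee_fin.
  by near: t; apply: nbhs_pinfty_ge; exact: num_real.
- have aE : a = -oo%E by apply/eqP; rewrite eq_le leNye andbT.
  apply: cvg_lim; first exact: Rhausdorff.
  apply/cvgrPdist_lt => e e0.
  have [N [+ mN Ne]] := integral_nbhs_small -oo%E (measurable_real_itvcc a b) iB' e0.
  move=> [M [_ MN]]; near=> t.
  have tb : (t%:E <= b)%E.
    apply: le_trans (ltW pb); rewrite lee_fin.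
    by near: t; apply: nbhs_ninfty_le; exact: num_real.
  rewrite (realE t) ?aE ?leNye// opprD addrACA subrr addr0 distrC.
  rewrite aE in Ne; apply: le_lt_trans Ne; rewrite -aE.
  apply: primitive_dist => //; rewrite ?aE ?leNye//.
  move=> y /andP[_ ty]; apply: MN; apply: le_lt_trans ty _; rewrite lte_fin.
  by near: t; apply: nbhs_ninfty_lt; exact: num_real.
Unshelve. all: by end_near. Qed.

End fundamental_theorem.

End integral_on_extended_line.

(** * Regulated functions *)

Section regulated_functions.
Context {R : realType}.
Implicit Types (a b x y c : \bar R) (f : \bar R -> R) (N : set (\bar R)).

Lemma nbhs_ereal_left N a x : nbhs x N -> (a < x)%E ->
  exists u, (a < u < x)%E /\ forall y, (u <= y <= x)%E -> N y.
Proof.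
case: x => [r| |]; last by rewrite ltNge leNye.
- move=> rN ar.
  have /nbhs_ballP[e /= e0 eN] : nbhs r (fun t : R => N t%:E) := rN.
  have [|u /andP[]] := @ereal_between _ (Order.max a (r - e)%:E) r%:E.
    by rewrite gt_max ar lte_fin gtrDl ltrNl oppr0.
  rewrite gt_max => /andP[au eu] ur; exists u%:E; split; first by rewrite au.
  move=> [t| |]; last by rewrite leNgt ltNyr.
  - rewrite !lee_fin => /andP[ut tr]; apply: eN; rewrite /ball/=. rewrite ger0_norm ?subr_ge0//.
    by move: eu; rewrite lte_fin; lra.
  - by rewrite [X in _ && X]leNgt ltry andbF.
- move=> [M [_ MN]] ay.
  have [|u /andP[]] := @ereal_between _ (Order.max a M%:E) +oo%E.
    by rewrite gt_max ay ltry.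
  rewrite gt_max => /andP[au eu] ur; exists u%:E; split; first by rewrite au ur.
  by move=> y /andP[uy _]; apply: MN; exact: lt_le_trans uy.
Qed.

Lemma nbhs_ereal_right N b x : nbhs x N -> (x < b)%E ->
  exists v, (x < v < b)%E /\ forall y, (x <= y <= v)%E -> N y.
Proof.
case: x => [r| |]; first last.
- move=> [M [_ MN]] yb.
  have [|v /andP[yv]] := @ereal_between _ -oo%E (Order.min b M%:E).
    by rewrite lt_min yb ltNyr.
  rewrite lt_min => /andP[vb vM]; exists v%:E; split; first by rewrite vb ltNyr.
  by move=> y /andP[_ yv']; apply: MN; exact: le_lt_trans vM.
- by rewrite ltNge leey.
- move=> rN rb.
  have /nbhs_ballP[e /= e0 eN] : nbhs r (fun t : R => N t%:E) := rN.
  have [|v /andP[rv]] := @ereal_between _ r%:E (Order.min b (r + e)%:E).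
    by rewrite lt_min rb lte_fin ltrDl.
  rewrite lt_min => /andP[vb ve]; exists v%:E; split; first by rewrite rv.
  move=> [t| |]; last by rewrite leNgt ltNyr.
  - rewrite !lee_fin => /andP[rt tv]; apply: eN; rewrite /ball/= distrC.
    by move: ve; rewrite ger0_norm ?subr_ge0// lte_fin; lra.
  - by rewrite [X in _ && X]leNgt ltry andbF.
Qed.

(** Compactness of [a, b] as an induction principle: a property of sets that
    passes to subsets and binary unions, and holds locally, holds for [a, b]. The
    supremum of the x such that [P] holds for [a, x] is reached and equals b. *)
Lemma ereal_itv_covering_ind a b (P : set (\bar R) -> Prop) : (a <= b)%E ->
  (forall S T, S `<=` T -> P T -> P S) ->
  (forall S T, P S -> P T -> P (S `|` T)) ->
  (forall x, (a <= x <= b)%E -> exists2 N, nbhs x N &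
     P (N `&` [set y | (a <= y <= b)%E])) ->
  P [set y | (a <= y <= b)%E].
Proof.
move=> ab PS PU Ploc.
pose Q := [set x | (a <= x <= b)%E /\ P [set y | (a <= y <= x)%E]].
have Qext q x N : Q q -> (q <= x)%E -> (x <= b)%E ->
    P (N `&` [set y | (a <= y <= b)%E]) ->
    (forall y, (q <= y <= x)%E -> N y) -> Q x.
  move=> [/andP[aq qb] Pq] qx xb PN qxN; split; first by rewrite (le_trans aq).
  apply: PS (PU _ _ Pq PN) => y /andP[ay yx].
  have [yq|/ltW qy] := leP y q; first by left; apply/andP.
  by right; split; [apply: qxN; rewrite qy|rewrite /= ay (le_trans yx)].
have Qa : Q a.
  split; first by rewrite lexx.
  have [|N aN PN] := Ploc a; first by rewrite lexx.
  apply: PS PN => y /andP[ay ya].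
  have -> : y = a by apply/eqP; rewrite eq_le ya.
  by split; [exact: nbhs_singleton aN|rewrite /= lexx].
pose s := ereal_sup Q.
have as_ : (a <= s)%E by exact: ereal_sup_ubound.
have sb : (s <= b)%E by apply: ge_ereal_sup => x [/andP[]].
have [|N sN PN] := Ploc s; first by rewrite as_.
have Qs : Q s.
  have [sa|] := leP s a.
    by have -> : s = a by apply/eqP; rewrite eq_le sa.
  move=> /(nbhs_ereal_left sN)[u [/andP[au us] uN]].
  have [q Qq uq] : exists2 q, Q q & (u < q)%E by exact: ereal_sup_gt.
  apply: (Qext q _ N) => //; first exact: ereal_sup_ubound.
  by move=> y /andP[qy ys]; apply: uN; rewrite ys andbT (le_trans (ltW uq)).
have [bs|] := leP b s.
  have -> : b = s by apply/eqP; rewrite eq_le bs.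
  exact: Qs.2.
move=> /(nbhs_ereal_right sN)[v [/andP[sv vb] vN]].
have : Q v by apply: (Qext s _ N) => //; exact: ltW.
by move/ereal_sup_ubound; rewrite leNgt sv.
Qed.

Lemma regulated_near f a b c (e : R) : regulated a b f -> (a <= c <= b)%E ->
  0 < e -> exists l r, exists2 N, nbhs c N & forall t, N t -> (a <= t <= b)%E ->
    ((t < c)%E -> `|l - f t| < e) /\ ((c < t)%E -> `|r - f t| < e).
Proof.
move=> [fl fr] /andP[ac cb] e0.
have [l [N1 cN1 N1l]] : exists l, exists2 N, nbhs c N &
    forall t, N t -> (a <= t)%E -> (t < c)%E -> `|l - f t| < e.
  move: ac; rewrite le_eqVlt => /predU1P[<-|ac].
    exists 0, setT; first exact: filterT.
    by move=> t _ at_; rewrite ltNge at_.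
  have acb : (a < c <= b)%E by rewrite ac.
  have /cvg_ex[l /cvgrPdist_lt/(_ _ e0) H] := fl c acb.
  by exists l; eexists; [exact: H|move=> t /= h _; exact: h].
have [r [N2 cN2 N2r]] : exists r, exists2 N, nbhs c N &
    forall t, N t -> (t <= b)%E -> (c < t)%E -> `|r - f t| < e.
  move: cb; rewrite le_eqVlt => /predU1P[->|cb].
    exists 0, setT; first exact: filterT.
    by move=> t _ tb; rewrite ltNge tb.
  have acb : (a <= c < b)%E by rewrite ac.
  have /cvg_ex[r /cvgrPdist_lt/(_ _ e0) H] := fr c acb.
  by exists r; eexists; [exact: H|move=> t /= h _; exact: h].
exists l, r, (N1 `&` N2); first exact: filterI.
by move=> t [tN1 tN2] /andP[at_ tb]; split; [exact: N1l|exact: N2r].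
Qed.

(** In a small neighbourhood of c, f stays close to its left limit before c and
    to its right limit after c, so that c is the only point there at which f can
    jump by [e]; [C] collects the centres of a finite cover. *)
Lemma regulated_finite_oscillation f a b (e : R) : (a <= b)%E ->
  regulated a b f -> 0 < e ->
  exists (C : seq (\bar R)) (M : R), forall x, (a <= x <= b)%E -> `|f x| <= M /\
    (x \notin C -> exists2 N, nbhs x N &
      forall t, N t -> (a <= t <= b)%E -> `|f t - f x| < e).
Proof.
move=> ab regf e0.
pose P S := exists (C : seq (\bar R)) (M : R),
  forall x, S x -> (a <= x <= b)%E -> `|f x| <= M /\
    (x \notin C -> exists2 N, nbhs x N &
      forall t, N t -> (a <= t <= b)%E -> `|f t - f x| < e).
suff [C [M H]] : P [set y | (a <= y <= b)%E].
  by exists C, M => x xab; exact: H.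
apply: ereal_itv_covering_ind => //.
- by move=> S T ST [C [M H]]; exists C, M => x /ST; exact: H.
- move=> S T [C [M H]] [C' [M' H']]; exists (C ++ C'), (Num.max M M') => x STx xab.
  rewrite mem_cat negb_or le_max.
  case: STx => [Sx|Tx].
    have [-> HC] := H _ Sx xab; split => // /andP[xC _]; exact: HC.
  have [-> HC] := H' _ Tx xab; split => [|/andP[_ xC]]; first by rewrite orbT.
  exact: HC.
- move=> c cab; have e20 : 0 < e / 2 by rewrite divr_gt0.
  have [l [r [N cN Nlr]]] := regulated_near regf cab e20.
  have {cN} cN' : nbhs c N° by apply: nbhs_interior.
  exists N° => //; exists [:: c], (`|l| + `|r| + `|f c| + e) => x [Nx _] xab.
  have side (D : set (\bar R)) (k : R) : open D -> D x ->
      (forall t, N t -> (a <= t <= b)%E -> D t -> `|k - f t| < e / 2) ->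
      `|f x| <= `|k| + e / 2 /\ exists2 N, nbhs x N &
      forall t, N t -> (a <= t <= b)%E -> `|f t - f x| < e.
    move=> oD Dx H; have kx := H x (interior_subset Nx) xab Dx; split.
      rewrite -[f x](subKr k) (le_trans (ler_normB _ _))// lerD2l.
      exact: ltW.
    exists (N `&` D); first by apply: filterI => //; exact: open_nbhs_nbhs.
    move=> t [Nt Dt] tab; have kt := H t Nt tab Dt.
    rewrite -(subrKA k) -(opprB k (f t)) [ltRHS]splitr addrC.
    rewrite (le_lt_trans (ler_normB _ _))// ltrD//.
  have [xc|cx|->] := ltgtP x c.
  + have [|||fx HN] := side [set t | (t < c)%E] l => //.
    * exact: open_ereal_lt_ereal.
    * by move=> t Nt tab; apply: (Nlr t Nt tab).1.
    split => //; apply: le_trans fx _.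
    by have := normr_ge0 r; have := normr_ge0 (f c); lra.
  + have [|||fx HN] := side [set t | (c < t)%E] r => //.
    * exact: open_ereal_gt_ereal.
    * by move=> t Nt tab; apply: (Nlr t Nt tab).2.
    split => //; apply: le_trans fx _.
    by have := normr_ge0 l; have := normr_ge0 (f c); lra.
  + split; last by rewrite inE eqxx.
    by have := normr_ge0 l; have := normr_ge0 r; lra.
Qed.

(** Off the countable union of the finite sets obtained for e = 1/(n+1), A is
    continuous. *)
Lemma regulated_measurable (A : R -> R) a b : (a <= b)%E ->
  regulated a b (extend A) -> measurable_fun (real_itvcc a b) A.
Proof.
move=> ab regA.
have /choice[C HC] : forall n : nat, exists C : seq (\bar R),
    forall x, (a <= x <= b)%E -> x \notin C -> exists2 N, nbhs x N &
      forall t, N t -> (a <= t <= b)%E ->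
        `|extend A t - extend A x| < n.+1%:R^-1.
  move=> n; have n0 : 0 < n.+1%:R^-1 :> R by rewrite invr_gt0.
  have [C [M H]] := regulated_finite_oscillation ab regA n0.
  by exists C => x xab; exact: (H x xab).2.
pose E : set R := \bigcup_n [set fine x | x in [set` C n]].
have cE : countable E.
  apply: bigcup_countable => // n _; apply: finite_set_countable.
  exact/finite_image/finite_seq.
have mE : measurable E by apply: countable_measurable => //; exact: measurable_set1.
have mD := measurable_real_itvcc a b.
have -> : real_itvcc a b = (real_itvcc a b `&` E) `|` (real_itvcc a b `\` E).
  by rewrite setUIDK.
apply/measurable_funU; [exact: measurableI|exact: measurableD|split].
- move=> _ Y mY; apply: countable_measurable; first exact: measurable_set1.
  by apply: sub_countable cE; apply: subset_card_le => t [[]].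
- apply: subspace_continuous_measurable_fun; first exact: measurableD.
  apply/subspace_continuousP => t [tD tE]; apply/cvgrPdist_lt => e e0.
  have [n /= ne] := filter_ex (near_infty_natSinv_lt (PosNum e0)).
  have [|N tN HN] := HC n t%:E tD.
    by apply/negP => tC; apply: tE; exists n => //; exists t%:E.
  suff : nbhs t (fun s => (real_itvcc a b `\` E) s -> `|A t - A s| < e) by [].
  have tN' : nbhs t (fun s : R => N s%:E) := tN.
  apply: filterS tN' => s /= Ns [sD _]; rewrite distrC (lt_trans _ ne)//.
  exact: (HN s%:E Ns sD).
Qed.

End regulated_functions.

(** * The Henstock-Stieltjes integral *)

Section gauge_estimate.
Context {R : realType}.
Local Notation mu := (@lebesgue_measure R).
Implicit Types (a b x y c : \bar R) (h : R -> R) (N : set (\bar R)).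

(** Gauges can thus be prescribed by arbitrary neighbourhoods; the open sets of
    the definition are met in three forms, for x = a, x = b and x between. *)
Lemma open_in_itv_nbhs a b x N : (a < b)%E -> (a <= x <= b)%E -> nbhs x N ->
  exists U, [/\ open_in_itv a b U, U x & U `<=` N].
Proof.
move=> ab /andP[]; rewrite le_eqVlt => /predU1P[<- _ aN|ax].
  have [v [/andP[av vb] vN]] := nbhs_ereal_right aN ab.
  exists [set y | (a <= y < v)%E]; split.
  - by exists v, v; rewrite av vb; split => //; apply: Or31.
  - by rewrite /= lexx.
  - by move=> y /andP[ay yv]; apply: vN; rewrite ay ltW.
rewrite le_eqVlt => /predU1P[xb|xb] xN.
  have [u [/andP[au ub] uN]] := nbhs_ereal_left xN ax.
  rewrite xb in ub uN *.
  exists [set y | (u < y <= b)%E]; split.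
  - by exists u, u; rewrite au ub; split => //; apply: Or33.
  - by rewrite /= lexx ub.
  - by move=> y /andP[uy yb]; apply: uN; rewrite yb ltW.
have [u [/andP[au ux] uN]] := nbhs_ereal_left xN ax.
have [v [/andP[xv vb] vN]] := nbhs_ereal_right xN xb.
exists [set y | (u < y < v)%E]; split.
- exists u, v; rewrite au vb (lt_trans ux xb) (lt_trans ax xv).
  by split => //; apply: Or32.
- by rewrite /= ux xv.
- move=> y /andP[uy yv]; have [yx|/ltW xy] := leP y x.
    by apply: uN; rewrite yx ltW.
  by apply: vN; rewrite xy ltW.
Qed.

Lemma integrable_scale (D : set R) h (r : R) : measurable D ->
  mu.-integrable D (EFin \o h) ->
  mu.-integrable D (EFin \o (fun t => r * h t)).
Proof.
move=> mD ih; rewrite (_ : EFin \o _ = fun t => (r%:E * (EFin \o h) t)%E).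
  exact: integrableZl.
by apply/funext => t; rewrite /= EFinM.
Qed.

Lemma integrable_sum_restrict (D : set R) h (S : \bar R -> set R)
    (C : seq (\bar R)) : measurable D -> (forall c, measurable (S c)) ->
  mu.-integrable D (EFin \o h) ->
  mu.-integrable D (EFin \o (fun t => \sum_(c <- C) (h \_ (S c)) t)) /\
  \int[mu]_(t in D) \sum_(c <- C) (h \_ (S c)) t =
    \sum_(c <- C) \int[mu]_(t in D `&` S c) h t.
Proof.
move=> mD mS ih; elim: C => [|c C [iC eC]].
  split; last by rewrite big_nil; under eq_Rintegral do rewrite big_nil;
    rewrite Rintegral_cst// mul0r.
  rewrite (_ : EFin \o _ = cst 0%E); first exact: integrable0.
  by apply/funext => t; rewrite /= big_nil.
have ic : mu.-integrable D (EFin \o (h \_ (S c))).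
  rewrite -restrict_EFin; apply/integrable_restrict; [exact: mS|exact: mD|].
  by apply: integrableS ih => //; exact: (measurableI _ _ mD (mS c)).
rewrite big_cons -eC Rintegral_mkcondr; split.
  rewrite (_ : EFin \o _ = (EFin \o (h \_ (S c))) \+
    (EFin \o (fun t => (\sum_(c <- C) (h \_ (S c)) t)%R)))%E.
    exact: integrableD.
  by apply/funext => t; rewrite /= big_cons EFinD.
rewrite -RintegralD//; apply: eq_Rintegral => t _.
by rewrite big_cons.
Qed.

End gauge_estimate.

Theorem proposition6p3 (R : realType) (a b : \bar R) (A B : R -> R)
  (hab : (a < b)%E)
  (hA : regulated a b (extend A))
  (hB : absolutely_continuous_ereal a b B)
  (hB' : (@lebesgue_measure R).-integrable
           [set t : R | (a <= t%:E <= b)%E] (fun t : R => (derive1 B t)%:E)) :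
  (@lebesgue_measure R).-integrable
    [set t : R | (a <= t%:E <= b)%E] (fun t : R => (A t * derive1 B t)%:E) /\
  is_HS_integral (extend A) (extend B) a b
    (\int[@lebesgue_measure R]_(t in [set t : R | (a <= t%:E <= b)%E])
       (A t * derive1 B t)).
Proof.
set mu := @lebesgue_measure R.
pose D := real_itvcc a b; rewrite -/D in hB' *.
set B' : R -> R := (derive1 B)%classic in hB' *.
have mD : measurable D by exact: measurable_real_itvcc.
have hab' := ltW hab.
have [K BK] := extend_primitive hab hB hB'.
pose f := extend A.
have iN : mu.-integrable D (EFin \o (fun t => `|B' t|)) by exact: integrable_norm.
have iAB : mu.-integrable D (EFin \o (fun t => A t * B' t)).
  rewrite (_ : EFin \o _ = (EFin \o A) \* (EFin \o B'))%E; last first.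
    by apply/funext => t; rewrite /= EFinM.
  apply: integrableMr => //; first exact: regulated_measurable.
  have [C [M HM]] := regulated_finite_oscillation hab' hA ltr01.
  exists M; split; first exact: num_real.
  move=> M' MM' t /= Dt; apply: le_trans (ltW MM').
  exact: (HM t%:E Dt).1.
split => // e e0.
pose L := \int[mu]_(t in D) `|B' t|.
have L0 : 0 <= L by apply: Rintegral_ge0.
(* The points outside C contribute at most e1 * L, which is below e / 2; the
   [size C] points of C at most (2 * M + 1) * eta each. The added 1 keeps the
   denominators positive. *)
pose e1 := e / (2 * (L + 1)).
have e10 : 0 < e1 by rewrite divr_gt0// mulr_gt0// ltr_wpDl.
have [C [M HC]] := regulated_finite_oscillation hab' hA e10.
have M0 : 0 <= M by apply: le_trans (HC a _).1; rewrite ?lexx.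
pose n := size C.
pose eta := e / (2 * (2 * M + 1) * n.+1%:R).
have K0 : 0 < 2 * M + 1 by rewrite ltr_wpDl// mulr_ge0.
have eta0 : 0 < eta by rewrite divr_gt0// !mulr_gt0.
have /choice[N HN] : forall c : \bar R, exists N : set (\bar R), [/\ nbhs c N,
    measurable [set t : R | N t%:E] &
    \int[mu]_(t in D `&` [set t : R | N t%:E]) `|B' t| < eta].
  by move=> c; apply: integral_nbhs_small.
have /choice[gamma Hg] : forall x : \bar R, exists U : set (\bar R),
    (a <= x <= b)%E -> [/\ open_in_itv a b U, U x &
      forall t, U t -> (a <= t <= b)%E ->
        if x \in C then N x t else `|f t - f x| < e1].
  move=> x; have [xab|] := boolP (a <= x <= b)%E; last by exists setT.
  have : exists2 V, nbhs x V & forall t, V t -> (a <= t <= b)%E ->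
      if x \in C then N x t else `|f t - f x| < e1.
    have [_|xC] := boolP (x \in C); last exact: (HC x xab).2.
    by exists (N x) => //; have [] := HN x.
  move=> [V xV HV]; have [U [oU Ux UV]] := open_in_itv_nbhs hab xab xV.
  by exists U => _; split => // t /UV; exact: HV.
exists gamma; first by move=> x /Hg[].
move=> s z [ps sz tg] fg.
(* The integrand of the error is dominated by k uniformly in the partition. The
   sum over C in w counts t once for each c whose neighbourhood contains it. *)
pose S c := [set t : R | N c t%:E].
pose w t := \sum_(c <- C) ((fun t => `|B' t|) \_ (S c)) t.
have [iw wE] : mu.-integrable D (EFin \o w) /\
    \int[mu]_(t in D) w t = \sum_(c <- C) \int[mu]_(t in D `&` S c) `|B' t|.
  by apply: integrable_sum_restrict => // c; have [] := HN c.
pose k t := e1 * `|B' t| + (2 * M + 1) * w t.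
have ik1 : mu.-integrable D (EFin \o (fun t => e1 * `|B' t|)).
  exact: integrable_scale.
have ik2 : mu.-integrable D (EFin \o (fun t => (2 * M + 1) * w t)).
  exact: integrable_scale.
have ik : mu.-integrable D (EFin \o k) by exact: integrableD ik1 ik2.
have kE : \int[mu]_(t in D) k t < e.
  rewrite RintegralD// !RintegralZl// wE -/L [ltRHS]splitr; apply: ltr_leD.
    rewrite /e1 invfM mulrA -mulrA gtr_pMr ?divr_gt0//.
    by rewrite mulrC ltr_pdivrMr ?mul1r ?ltrDl ?ltr_wpDl.
  apply: (@le_trans _ _ ((2 * M + 1) * (eta * n%:R))).
    rewrite ler_pM2l// mulr_natr -[n]count_predT -iter_addr_0 -big_const_seq.
    by apply: ler_sum => c _; have [_ _ /ltW] := HN c.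
  have -> : (2 * M + 1) * (eta * n%:R) = e / 2 * (n%:R / n.+1%:R).
    rewrite /eta; move: (n.+1%:R) (ltr0Sn R n) => q q0.
    by field; rewrite !gt_eqF.
  by rewrite ler_piMr ?divr_ge0 1?ltW// ltr_pdivrMr// mul1r ltr_nat.
pose X i := nth a (a :: s) i.
have Xab i : (i <= size s)%N -> (a <= X i <= b)%E.
  move=> si; rewrite /X (set_nth_default b)//.
  by rewrite (itv_partition_nth_ge _ ps)// (itv_partition_nth_le _ ps).
have X0 : X 0%N = a by [].
have Xs : X (size s) = b.
  rewrite /X; exact: itv_partition_nth_size ps.
have Xle i : (i < size s)%N -> (X i <= X i.+1)%E.
  by move=> /tg/andP[] /le_trans; exact.
have Bincr x y : (a <= x)%E -> (x <= y)%E -> (y <= b)%E ->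
    extend B y - extend B x = \int[mu]_(t in real_itvoc x y) B' t.
  move=> ax xy yb; rewrite !BK ?ax ?yb ?(le_trans ax) ?(le_trans xy)//.
  by rewrite -(primitiveB hB')//; lra.
pose Phi := primitive a (fun t => A t * B' t).
have sumE h : mu.-integrable D (EFin \o h) ->
    \sum_(i < size s) (primitive a h (X i.+1) - primitive a h (X i)) =
    \int[mu]_(t in D) h t.
  move=> ih.
  rewrite -(big_mkord xpredT (fun i => primitive a h (X i.+1) - primitive a h (X i))).
  rewrite telescope_sumr// X0 Xs (Rintegral_real_itvcc ih)//.
  rewrite [X in _ - X]/primitive (_ : real_itvoc a a = set0) ?Rintegral_set0 ?subr0//.
  by apply/seteqP; split => // t /andP[at_]; rewrite leNgt at_.
(* Both integrals over D are sums over the subintervals, so that the estimate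
   reduces to a single subinterval, and there to a pointwise one. *)
rewrite -(sumE _ iAB) /stieltjes_sum -sumrB.
apply: le_lt_trans kE; rewrite -(sumE _ ik).
apply: le_trans (ler_norm_sum _ _ _) _; apply: ler_sum => i _.
have is_ := ltn_ord i.
have /andP[aX Xb] := Xab i (ltnW is_).
have /andP[aX' Xb'] := Xab i.+1 is_.
have XX := Xle i is_.
rewrite -/(X i) -/(X i.+1) Bincr// (primitiveB iAB)// (primitiveB ik)//.
have mJ : measurable (real_itvoc (X i) (X i.+1)) by exact: measurable_real_itvoc.
have iJ h : mu.-integrable D (EFin \o h) ->
    mu.-integrable (real_itvoc (X i) (X i.+1)) (EFin \o h).
  by move=> ih; exact: (integrable_real_itvoc ih).
have ifB : mu.-integrable (real_itvoc (X i) (X i.+1))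
    (EFin \o (fun t => f (nth a z i) * B' t)).
  exact: integrable_scale mJ (iJ _ hB').
rewrite -RintegralZl//; last exact: iJ.
rewrite -RintegralB//; last exact: iJ.
have iDiff : mu.-integrable (real_itvoc (X i) (X i.+1))
    (EFin \o (fun t => f (nth a z i) * B' t - A t * B' t)).
  by exact: integrableB ifB (iJ _ iAB).
apply: le_trans (le_normr_Rintegral _ _) _ => //.
apply: le_Rintegral => //; [exact: integrable_norm|exact: iJ|].
move=> t /andP[xt tx].
have tab : (a <= t%:E <= b)%E.
  by rewrite (le_trans aX (ltW xt)) (le_trans tx Xb').
have zab : (a <= nth a z i <= b)%E.
  by have /andP[h1 h2] := tg i is_; rewrite (le_trans aX h1) (le_trans h2).
have gt : gamma (nth a z i) t%:E by apply: (fg i is_); rewrite /= (ltW xt).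
have [_ _ /(_ _ gt tab)] := Hg _ zab.
rewrite -mulrBl normrM /k.
have w0 c : 0 <= ((fun t => `|B' t|) \_ (S c)) t by rewrite patchE; case: ifP.
(* A tag in C gives t in its neighbourhood and the crude bound 2 * M; any other
   tag has A t within e1 of its own value. *)
case: ifPn => [zC Nzt|zC].
  have wt : `|B' t| <= w t.
    rewrite /w (perm_big _ (perm_to_rem zC)) big_cons/= patchE mem_set//.
    by rewrite lerDl sumr_ge0.
  rewrite -[leLHS]add0r; apply: lerD; first by rewrite mulr_ge0// ltW.
  apply: ler_pM => //; apply: le_trans (ler_normB _ _) _.
  have := (HC _ zab).1; have := (HC _ tab).1; rewrite /f/=; lra.
rewrite distrC => ft; rewrite -[leLHS]addr0; apply: lerD.
  by rewrite ler_wpM2r// ltW.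
by rewrite mulr_ge0 ?sumr_ge0// ltW.
Qed.
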